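(* Let $X\neq\{0\}$ be a real Hilbert space, let $m\in\{2,3,\ldots\}$, $I=\{1,\ldots,m\}$, let $A_1,\ldots,A_m$ be maximally monotone operators on $X$, and let $\lambda_1,\ldots,\lambda_m\in\left]0,1\right[$ satisfy $\sum_{i\in I}\lambda_i=1$. Put $\mu_i=1-\lambda_i$ for $i\in I$, $J_A=\sum_{i\in I}\lambda_iJ_{A_i}$, and $$\mathbf{S}=\Big\{\mathbf{x}=(x_i)_{i\in I}\in X^m \;\Big|\; (\forall i\in I)\;\; x_i=J_{\mu_i^{-1}A_i}\Big(\sum_{j\in I\smallsetminus\{i\}}\frac{\lambda_j}{\mu_i}x_j\Big)\Big\}.$$ Then the operator $$L\colon \mathbf{S}\to\operatorname{Fix}J_A\colon \mathbf{x}=(x_i)_{i\in I}\mapsto\sum_{i\in I}\lambda_ix_i$$ is well defined, bijective, and Lipschitz continuous with constant $1$. Furthermore, the inverse operator of $L$ satisfies $$L^{-1}\colon\operatorname{Fix}J_A\to\mathbf{S}\colon x\mapsto\big(J_{A_i}x\big)_{i\in I},$$ and $L^{-1}$ is Lipschitz continuous with constant $\sqrt{m}$.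
   Context: A set-valued operator $B\colon X\rightrightarrows X$ is monotone if $\langle x-y,u-v\rangle\geq 0$ whenever $u\in Bx$ and $v\in By$; it is maximally monotone if it is monotone and no proper extension of (the graph of) $B$ is monotone. For a maximally monotone operator $B$ on $X$, its resolvent is $J_B=(\operatorname{Id}+B)^{-1}$, which is a single-valued mapping defined on all of $X$; $\operatorname{Id}$ is the identity. For $T\colon X\to X$, $\operatorname{Fix}T=\{x\in X\mid x=Tx\}$. The product $\mathbf{X}=X^m$ is a Hilbert space with inner product $\langle\mathbf{x},\mathbf{y}\rangle=\sum_{i\in I}\langle x_i,y_i\rangle$ for $\mathbf{x}=(x_i)_{i\in I}$, $\mathbf{y}=(y_i)_{i\in I}$, and the corresponding norm; $\mathbf{S}\subseteq\mathbf{X}$ carries the induced metric. The mapping $J_A=\sum_{i\in I}\lambda_iJ_{A_i}$ is the resolvent of the maximally monotone operator $A=\big(\sum_{i\in I}\lambda_iJ_{A_i}\big)^{-1}-\operatorname{Id}$. *)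

(* Defs.v *)
From HB Require Import structures.
From mathcomp Require Import all_boot all_order all_algebra.
From mathcomp Require Import all_classical all_reals all_analysis.

Set Implicit Arguments.
Unset Strict Implicit.
Unset Printing Implicit Defensive.

Import Order.TTheory GRing.Theory Num.Theory.
Import numFieldNormedType.Exports.

Local Open Scope classical_set_scope.
Local Open Scope ring_scope.

(* A real Hilbert space is a complete normed module [X] over a [realType],
   together with a form [dot : {dot X for idfun}] that induces its norm.
   A set-valued operator on [X] is a function [X -> set X]. *)
Definition induces_norm (R : realType) (X : normedModType R)
    (dot : {dot X for idfun}) : Prop :=
  forall x : X, dot x x = `|x| ^+ 2.

Definition monotone_op (R : realType) (X : normedModType R)
    (dot : {dot X for idfun}) (B : X -> set X) : Prop :=
  forall x y u v : X, B x u -> B y v -> 0 <= dot (x - y) (u - v).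

Definition maximally_monotone (R : realType) (X : normedModType R)
    (dot : {dot X for idfun}) (B : X -> set X) : Prop :=
  monotone_op dot B /\
  forall C : X -> set X,
    monotone_op dot C -> (forall x, B x `<=` C x) -> C = B.

Definition scale_op (R : realType) (X : normedModType R) (c : R)
    (B : X -> set X) : X -> set X :=
  fun x => [set c *: u | u in B x].

Definition id_plus_op (R : realType) (X : normedModType R)
    (B : X -> set X) : X -> set X :=
  fun x => [set x + u | u in B x].

Definition inverse_op (T U : Type) (B : T -> set U) : U -> set T :=
  fun u => [set x | B x u].

(* The default value 0 is irrelevant for a maximally monotone [B] on a Hilbert
   space: by Minty's theorem the value of (Id + B)^-1 at every point is then a
   singleton. *)
Definition resolvent (R : realType) (X : normedModType R)
    (B : X -> set X) : X -> X :=
  fun x => xget 0 (inverse_op (id_plus_op B) x).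

Definition fix_set (T : Type) (f : T -> T) : set T := [set x | x = f x].

Definition prod_dot (R : realType) (X : normedModType R)
    (dot : {dot X for idfun}) (m : nat) (x y : {ffun 'I_m -> X}) : R :=
  \sum_(i < m) dot (x i) (y i).

(* The Euclidean product norm; any norm or topology that the library may put on
   finite functions is not used. *)
Definition prod_norm (R : realType) (X : normedModType R)
    (dot : {dot X for idfun}) (m : nat) (x : {ffun 'I_m -> X}) : R :=
  Num.sqrt (prod_dot dot x x).

(* Main.v *)
Require Import Defs.
From HB Require Import structures.
From mathcomp Require Import all_boot all_order all_algebra.
From mathcomp Require Import all_classical all_reals all_analysis.
From mathcomp Require Import ring lra.

Set Implicit Arguments.
Unset Strict Implicit.
Unset Printing Implicit Defensive.

Import Order.TTheory GRing.Theory Num.Theory.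
Import numFieldNormedType.Exports.

Local Open Scope classical_set_scope.
Local Open Scope ring_scope.

(** Write [L x] for the average of the [x i] with weights [lambda i], and
    [Linv x] for the family of the resolvents of the [A i] at [x].

    For a maximally monotone [B], the point [x] is the resolvent of [B] at [w]
    exactly when [w - x] belongs to [B x] ([resolventP]).  Hence the equation
    defining the [i]-th constraint of [S] says that the leave-one-out average
    minus [x i] belongs to [(mu i)^-1 *: A i (x i)]; multiplying by [mu i]
    turns this into [L x - x i] belonging to [A i (x i)], that is, [x i] is the
    resolvent of [A i] at [L x] ([resolvent_regrouped_eq]).  So [S] is the fixed
    point set of [Linv \o L], whereas [JA] is [L \o Linv]; it is then formal that
    [L] and [Linv] are inverse bijections between the two fixed point sets.
    The constant 1 comes from convexity and from the fact that each coordinate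
    norm is at most the product norm; the constant [sqrt m] comes from the
    nonexpansiveness of each resolvent.

    The analytic ingredient is Minty's theorem ([minty]): the resolvent of a
    maximally monotone operator is defined everywhere.  It is proved with the
    Fitzpatrick function of the operator.  Adding half the squared norm of the
    product space makes that function strongly convex, so that it has a minimizer
    by completeness ([fitzpatrick_min_exists]), and the optimality condition at
    the minimizer produces a solution of the inclusion ([minty_zero]). *)

(** * Inner product and product norm *)

Section InnerProduct.
Variables (R : realType) (X : normedModType R) (dot : {dot X for idfun}).

Lemma dotC (x y : X) : dot x y = dot y x.
Proof. by rewrite hermC /= expr0 mul1r. Qed.

Lemma dotDl (x y z : X) : dot (x + y) z = dot x z + dot y z.
Proof. by rewrite linearDl. Qed.

Lemma dotDr (x y z : X) : dot x (y + z) = dot x y + dot x z.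
Proof. by rewrite linearD. Qed.

Lemma dotNl (x z : X) : dot (- x) z = - dot x z.
Proof. by rewrite linearNl. Qed.

Lemma dotNr (x z : X) : dot x (- z) = - dot x z.
Proof. by rewrite linearN. Qed.

Lemma dotZl a (x z : X) : dot (a *: x) z = a * dot x z.
Proof. by rewrite linearZl_LR. Qed.

Lemma dotZr a (x z : X) : dot x (a *: z) = a * dot x z.
Proof. by rewrite linearZ. Qed.

Definition dotE := (dotDl, dotDr, dotNl, dotNr, dotZl, dotZr).

Hypothesis dot_norm : induces_norm dot.

Lemma normsqE (x : X) : `|x| ^+ 2 = dot x x.
Proof. by rewrite dot_norm. Qed.

Lemma normsq_convex_comb (s : R) (a b : X) :
  `|(1 - s) *: a + s *: b| ^+ 2 =
  (1 - s) * `|a| ^+ 2 + s * `|b| ^+ 2 - s * (1 - s) * `|a - b| ^+ 2.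
Proof. by rewrite !normsqE !dotE (dotC b a); ring. Qed.

Lemma prod_dotxx m (x : {ffun 'I_m -> X}) :
  prod_dot dot x x = \sum_(i < m) `|x i| ^+ 2.
Proof. by apply: eq_bigr => i _; rewrite dot_norm. Qed.

Lemma norm_coord_le m (x : {ffun 'I_m -> X}) i : `|x i| <= prod_norm dot x.
Proof.
rewrite -(normr_id (x i)) -sqrtr_sqr /prod_norm prod_dotxx ler_sqrt; last first.
  by rewrite sumr_ge0// => j _; rewrite exprn_ge0.
by rewrite (bigD1 i)//= lerDl sumr_ge0// => j _; rewrite exprn_ge0.
Qed.

Lemma norm_convex_comb_le m (a : 'I_m -> R) (x : {ffun 'I_m -> X}) :
  (forall i, 0 <= a i) -> \sum_(i < m) a i = 1 ->
  `|\sum_(i < m) a i *: x i| <= prod_norm dot x.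
Proof.
move=> a_ge0 a_sum; apply: le_trans (ler_norm_sum _ _ _) _.
rewrite -[leRHS]mul1r -a_sum mulr_suml; apply: ler_sum => i _.
by rewrite normrZ ger0_norm// ler_wpM2l// norm_coord_le.
Qed.

Lemma prod_norm_le m (x : {ffun 'I_m -> X}) (c : R) :
  (forall i, `|x i| <= c) -> prod_norm dot x <= Num.sqrt m%:R * c.
Proof.
case: m x => [|m] x xc.
  by rewrite /prod_norm /prod_dot big_ord0 sqrtr0 mul0r.
have c_ge0 : 0 <= c by exact: le_trans (xc ord0).
rewrite -[X in _ * X]ger0_norm// -sqrtr_sqr -sqrtrM ?ler0n// /prod_norm.
rewrite ler_sqrt ?mulr_ge0 ?exprn_ge0// prod_dotxx.
apply: (@le_trans _ _ (\sum_(i < m.+1) c ^+ 2)).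
  by apply: ler_sum => i _; rewrite lerXn2r ?nnegrE.
by rewrite sumr_const card_ord mulr_natl.
Qed.

End InnerProduct.

(** * Maximally monotone operators *)

Section MaximalMonotonicity.
Variables (R : realType) (X : normedModType R) (dot : {dot X for idfun}).
Implicit Types B : X -> set X.

(** The pointwise form of maximality: every pair monotonically related to the
    graph of [B] belongs to it. *)
Lemma maximally_monotoneP B :
  maximally_monotone dot B <->
  monotone_op dot B /\
  forall x u, (forall y v, B y v -> 0 <= dot (x - y) (u - v)) -> B x u.
Proof.
split=> [[Bmon Bmax]|[Bmon Bmax]]; split=> //.
  move=> x u xu.
  pose C := fun x' => [set u' | B x' u' \/ x' = x /\ u' = u].
  have <- : C = B; last by right.
  apply: Bmax => [y z v w|y v Byv]; last by left.
  case=> [Byv|[-> ->]] [Bzw|[-> ->]].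
  - exact: Bmon.
  - by rewrite -(opprB x) -(opprB u) dotNl dotNr opprK; exact: xu.
  - exact: xu.
  - by rewrite !subrr linear0.
move=> C Cmon BC; apply/funext => x.
apply/seteqP; split=> [u Cxu|]; last exact: BC.
by apply: Bmax => y v /BC; exact: Cmon.
Qed.

Lemma maximally_monotone_nonempty B :
  maximally_monotone dot B -> exists y v, B y v.
Proof.
move=> /maximally_monotoneP[_ Bmax]; apply: contrapT => B0.
by apply: (B0); exists 0, 0; apply: Bmax => y v Byv; case: B0; exists y, v.
Qed.

Lemma maximally_monotone_scale (c : R) B : 0 < c ->
  maximally_monotone dot B -> maximally_monotone dot (scale_op c B).
Proof.
move=> c_gt0 /maximally_monotoneP[Bmon Bmax]; apply/maximally_monotoneP; split.
  move=> x y _ _ [u Bxu <-] [v Byv <-].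
  by rewrite -scalerBr dotZr mulr_ge0 ?(ltW c_gt0)//; exact: Bmon.
move=> x u xu; exists (c^-1 *: u); last first.
  by rewrite scalerA mulfV ?gt_eqF ?scale1r.
apply: Bmax => y v Byv.
have /xu : scale_op c B y (c *: v) by exists v.
have -> : u - c *: v = c *: (c^-1 *: u - v).
  by rewrite scalerBr scalerA mulfV ?gt_eqF ?scale1r.
by rewrite dotZr pmulr_rge0.
Qed.

Lemma maximally_monotone_translate (w : X) B :
  maximally_monotone dot B ->
  maximally_monotone dot (fun x => [set u | B x (u + w)]).
Proof.
have addKw (u v : X) : u + w - (v + w) = u - v by rewrite (addrC v) addrKA.
move=> /maximally_monotoneP[Bmon Bmax]; apply/maximally_monotoneP; split.
  by move=> x y u v /= Bxu Byv; rewrite -(addKw u v); exact: Bmon.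
move=> x u xu; apply: Bmax => y v Byv.
by have := xu y (v - w); rewrite /= subrK => /(_ Byv); rewrite opprB addrA addrAC.
Qed.

End MaximalMonotonicity.

(** * Minty's theorem *)

Section Minty.
Variables (R : realType) (X : normedModType R) (dot : {dot X for idfun}).
Hypothesis dot_norm : induces_norm dot.
Variable B : X -> set X.

(** Let [F] be the Fitzpatrick function of [B], the supremum over the graph points
    [(y, v)] of [dot x v + dot y u - dot y v].  Expanding the squares, the
    inequality below says [F (x, u) + (`|x| ^+ 2 + `|u| ^+ 2) / 2 <= c / 2]:
    [fitzpatrick_sublevel x u c] is a sublevel set, up to the factor 2, of the
    regularized Fitzpatrick function.  Written this way it is an intersection
    of balls, no infinite value of [F] occurs, and it is closed by continuity
    of the norm alone. *)
Definition fitzpatrick_sublevel (x u : X) (c : R) : Prop :=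
  forall y v, B y v -> `|x + v| ^+ 2 + `|u + y| ^+ 2 <= `|y + v| ^+ 2 + c.

Lemma fitzpatrick_sublevelW x u c c' : c <= c' ->
  fitzpatrick_sublevel x u c -> fitzpatrick_sublevel x u c'.
Proof. by move=> cc' xu y v /xu /le_trans; apply; rewrite lerD2l. Qed.

(** Strong convexity of the regularized Fitzpatrick function, with modulus coming
    from the squared norm. *)
Lemma fitzpatrick_sublevel_convex (s : R) x u c x' u' c' : 0 <= s <= 1 ->
  fitzpatrick_sublevel x u c -> fitzpatrick_sublevel x' u' c' ->
  fitzpatrick_sublevel ((1 - s) *: x + s *: x') ((1 - s) *: u + s *: u')
    ((1 - s) * c + s * c' - s * (1 - s) * (`|x - x'| ^+ 2 + `|u - u'| ^+ 2)).
Proof.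
move=> /andP[s0 s1] xu xu' y v Byv.
have shift (a b d : X) :
    (1 - s) *: a + s *: b + d = (1 - s) *: (a + d) + s *: (b + d).
  by rewrite !scalerDr addrACA -scalerDl subrK scale1r.
have cancel_shift (a b d : X) : a + d - (b + d) = a - b.
  by rewrite (addrC b) addrKA.
rewrite !shift !(normsq_convex_comb dot_norm) !cancel_shift.
have := ler_wpM2l s0 (xu' _ _ Byv).
have : 0 <= 1 - s by rewrite subr_ge0.
move=> /ler_wpM2l /(_ _ _ (xu _ _ Byv)).
lra.
Qed.

(** On the graph of a monotone [B], the Fitzpatrick function is at most [dot y v]. *)
Lemma fitzpatrick_sublevel_graph y v : monotone_op dot B -> B y v ->
  fitzpatrick_sublevel y v (`|y + v| ^+ 2).
Proof.
move=> Bmon Byv y' v' Byv'; have := Bmon _ _ _ _ Byv Byv'.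
rewrite !(normsqE dot_norm) !dotE (dotC _ v y) (dotC _ v' y) (dotC _ y' v).
rewrite (dotC _ v' y') (dotC _ v y').
lra.
Qed.

Hypothesis Bmax : maximally_monotone dot B.

(** By maximality, the Fitzpatrick function dominates [dot x u] everywhere. *)
Lemma fitzpatrick_sublevel_ge x u c :
  fitzpatrick_sublevel x u c -> `|x + u| ^+ 2 <= c.
Proof.
move=> xu; rewrite leNgt; apply/negP => c_lt.
(* A level below this bound would make [(x, u)] monotonically related to the
   graph, hence a point of it. *)
have /xu : B x u.
  have /maximally_monotoneP[_] := Bmax; apply=> y v /xu; move: c_lt.
  rewrite !(normsqE dot_norm) !dotE (dotC _ u x) (dotC _ v x) (dotC _ y u).
  rewrite (dotC _ v y).
  lra.
by rewrite [u + x]addrC; lra.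
Qed.

(** Two points within [d] of a lower bound of the levels are close to each other:
    compare that bound with the level of their midpoint. *)
Lemma fitzpatrick_near_min_dist (c0 d c c' : R) x u x' u' :
  (forall y v b, fitzpatrick_sublevel y v b -> c0 <= b) ->
  c <= c0 + d -> c' <= c0 + d ->
  fitzpatrick_sublevel x u c -> fitzpatrick_sublevel x' u' c' ->
  `|x - x'| ^+ 2 + `|u - u'| ^+ 2 <= 4 * d.
Proof.
move=> c0_le cd c'd xu xu'.
have half01 : 0 <= (2^-1 : R) <= 1 by apply/andP; split; lra.
have /c0_le := fitzpatrick_sublevel_convex half01 xu xu'.
lra.
Qed.

End Minty.

Section MintyComplete.
Variables (R : realType) (X : completeNormedModType R) (dot : {dot X for idfun}).
Hypothesis dot_norm : induces_norm dot.
Variable B : X -> set X.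
Hypothesis Bmax : maximally_monotone dot B.

Lemma cvg_of_dist_harmonic (u_ : nat -> X) :
  (forall N n, (N <= n)%N -> `|u_ N - u_ n| ^+ 2 <= 4 * N.+1%:R^-1) ->
  cvg (u_ @ \oo).
Proof.
move=> u_le; apply: cauchy_cvg; apply: cauchy_exP => e e_gt0.
have e4 : 0 < e ^+ 2 / 4 by rewrite divr_gt0 ?exprn_gt0.
have [N _ Ne] := near_infty_natSinv_lt (PosNum e4).
exists (u_ N); exists N => // n /= Nn; rewrite -ball_normE /=.
rewrite -(@ltr_pXn2r _ 2) ?nnegrE ?(ltW e_gt0)//.
apply: le_lt_trans (u_le _ _ Nn) _.
by rewrite mulrC -ltr_pdivlMr// Ne /=.
Qed.

(** Strong convexity makes every minimizing sequence Cauchy, so completeness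
    suffices and no weak compactness is needed. *)
Lemma fitzpatrick_min_exists : exists x u c,
  fitzpatrick_sublevel B x u c /\
  forall x' u' c', fitzpatrick_sublevel B x' u' c' -> c <= c'.
Proof.
pose C : set R := [set c | exists x u, fitzpatrick_sublevel B x u c].
have Clb : has_lbound C.
  exists 0 => c [x [u /(fitzpatrick_sublevel_ge dot_norm Bmax)]].
  by apply: le_trans; rewrite exprn_ge0.
have Cinf : has_inf C.
  split=> //; have [y [v Byv]] := maximally_monotone_nonempty Bmax.
  exists (`|y + v| ^+ 2), y, v; apply: (fitzpatrick_sublevel_graph dot_norm) => //.
  by case: Bmax.
have inf_le x u c : fitzpatrick_sublevel B x u c -> inf C <= c.
  by move=> xu; apply: ge_inf => //; exists x, u.
have /choice[z zP] n : exists z : X * X,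
    fitzpatrick_sublevel B z.1 z.2 (inf C + n.+1%:R^-1).
  have n_gt0 : 0 < n.+1%:R^-1 :> R by rewrite invr_gt0 ltr0n.
  have [c [x [u xu]] /ltW c_le] := inf_adherent n_gt0 Cinf.
  by exists (x, u); apply: fitzpatrick_sublevelW xu.
have z_le N n : (N <= n)%N ->
    `|(z N).1 - (z n).1| ^+ 2 + `|(z N).2 - (z n).2| ^+ 2 <= 4 * N.+1%:R^-1.
  move=> Nn.
  apply: (fitzpatrick_near_min_dist dot_norm inf_le _ _ (zP N) (zP n)) => //.
  by rewrite lerD2l lef_pV2 ?posrE ?ltr0n// ler_nat.
have /cvg_ex[x zx] : cvg ((fun n => (z n).1) @ \oo).
  apply: cvg_of_dist_harmonic => N n /z_le; apply: le_trans.
  by rewrite lerDl exprn_ge0.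
have /cvg_ex[u zu] : cvg ((fun n => (z n).2) @ \oo).
  apply: cvg_of_dist_harmonic => N n /z_le; apply: le_trans.
  by rewrite lerDr exprn_ge0.
exists x, u, (inf C); split=> // y v Byv.
have lhs_cvg : (fun n => `|(z n).1 + v| ^+ 2 + `|(z n).2 + y| ^+ 2) @ \oo -->
    `|x + v| ^+ 2 + `|u + y| ^+ 2.
  by apply: cvgD; rewrite expr2; apply: cvgM; apply: cvg_norm;
    apply: cvgD => //; exact: cvg_cst.
have rhs_cvg : (fun n => `|y + v| ^+ 2 + (inf C + harmonic n)) @ \oo -->
    `|y + v| ^+ 2 + inf C.
  rewrite -[X in _ --> _ + X]addr0.
  apply: cvgD; first exact: cvg_cst.
  by apply: cvgD; [exact: cvg_cst|exact: cvg_harmonic].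
apply: ler_cvg_to lhs_cvg rhs_cvg _.
by apply: nearW => n; exact: zP.
Qed.

(** At a minimizer [(x, u)] of the regularized Fitzpatrick function, the
    first-order optimality condition tested on graph points shows that
    [(- u, - x)] is monotonically related to the graph, hence lies in it;
    testing it on that very point forces [u = - x]. *)
Lemma minty_zero : exists x, B x (- x).
Proof.
have [x [u [c [xu c_le]]]] := fitzpatrick_min_exists.
have [Bmon Bsat] := (maximally_monotoneP dot B).1 Bmax.
have c_ge := fitzpatrick_sublevel_ge dot_norm Bmax xu.
have opt y v : B y v -> c + (`|x - y| ^+ 2 + `|u - v| ^+ 2) <= `|y + v| ^+ 2.
  move=> Byv; have yv := fitzpatrick_sublevel_graph dot_norm Bmon Byv.
  (* Minimality along the segment from [(x, u)] to [(y, v)] at a parameter [s]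
     in ]0, 1], divided by [s], bounds [c + D - s * D] by the right-hand side; here [s]
     is taken small enough for [s * D <= e]. *)
  set D := `|x - y| ^+ 2 + _.
  apply/ler_addgt0Pr => e e_gt0.
  pose s := e / (e + D + 1).
  have D_ge0 : 0 <= D by rewrite addr_ge0 ?exprn_ge0.
  have s_gt0 : 0 < s by rewrite divr_gt0//; lra.
  have s_le1 : s <= 1 by rewrite ler_pdivrMr; lra.
  have sD_le : s * D <= e.
    rewrite /s mulrAC ler_pdivrMr; last lra.
    by rewrite ler_wpM2l ?ltW//; lra.
  have s01 : 0 <= s <= 1 by rewrite ltW.
  have /c_le := fitzpatrick_sublevel_convex dot_norm s01 xu yv.
  rewrite -/D => c_opt.
  have : s * (c + D - s * D - `|y + v| ^+ 2) <= 0 by lra.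
  rewrite pmulr_rle0//; lra.
have Bux : B (- u) (- x).
  apply: Bsat => y v /opt; move: c_ge; rewrite !(normsqE dot_norm) !dotE.
  rewrite (dotC _ u x) (dotC _ y x) (dotC _ v u) (dotC _ v y).
  have := sqr_ge0 `|x + u|; rewrite (normsqE dot_norm) !dotE (dotC _ u x).
  lra.
suff ux : - u = x by exists x; rewrite -{1}ux.
have := opt _ _ Bux; rewrite !opprK -opprD normrN [u + x]addrC => opt_le.
have : `|x + u| ^+ 2 <= 0 by have := sqr_ge0 `|x + u|; lra.
by rewrite exprn_even_le0//= normr_eq0 addr_eq0 => /eqP ->.
Qed.

End MintyComplete.

(** * Resolvents *)

Section Resolvent.
Variables (R : realType) (X : completeNormedModType R) (dot : {dot X for idfun}).
Hypothesis dot_norm : induces_norm dot.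
Implicit Types B : X -> set X.

(** Surjectivity of [Id + B], obtained from the case of the value 0 by a
    translation. *)
Lemma minty B : maximally_monotone dot B ->
  forall w, exists x, B x (w - x).
Proof.
move=> /maximally_monotone_translate Bmax w.
by have [x] := minty_zero dot_norm (Bmax w); rewrite /= addrC; exists x.
Qed.

Lemma monotone_shifted_graph_nonexpansive B x y w z : monotone_op dot B ->
  B x (w - x) -> B y (z - y) -> `|x - y| <= `|w - z|.
Proof.
move=> Bmon Bxw Byz; have := Bmon _ _ _ _ Bxw Byz.
have -> : w - x - (z - y) = (w - z) - (x - y).
  by rewrite !opprB addrACA [RHS]addrACA (addrC (- x)).
move: (x - y) (w - z) => a b ab; rewrite -(@ler_pXn2r _ 2) ?nnegrE//.
have := sqr_ge0 `|b - a|; rewrite !(normsqE dot_norm); move: ab.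
rewrite !dotE (dotC _ b a); lra.
Qed.

Lemma resolventP B (w x : X) : maximally_monotone dot B ->
  x = resolvent B w <-> B x (w - x).
Proof.
move=> Bmax; have [Bmon _] := Bmax.
have resE y : inverse_op (id_plus_op B) w y <-> B y (w - y).
  split=> [[u Byu <-]|Byw]; first by rewrite addrC addKr.
  by exists (w - y) => //; rewrite addrC subrK.
have /(xgetPex 0)/resE res_in : exists y, inverse_op (id_plus_op B) w y.
  by have [y Byw] := minty Bmax w; exists y; apply/resE.
split=> [->//|Bxw]; apply/eqP; rewrite -subr_eq0 -normr_le0.
have := monotone_shifted_graph_nonexpansive Bmon Bxw res_in.
by rewrite subrr normr0.
Qed.

Lemma resolvent_nonexpansive B (w z : X) : maximally_monotone dot B ->
  `|resolvent B w - resolvent B z| <= `|w - z|.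
Proof.
move=> Bmax; apply: (monotone_shifted_graph_nonexpansive Bmax.1).
  by apply/(resolventP _ _ Bmax).
by apply/(resolventP _ _ Bmax).
Qed.

(** Scaling the inclusion by [1 - lambda i] and moving the term [lambda i *: x i]
    from one side to the other turns the equation with the leave-one-out average
    into an equation with the full average. *)
Lemma resolvent_regrouped_eq (m : nat) (A : 'I_m -> X -> set X)
    (lambda : 'I_m -> R) (x : {ffun 'I_m -> X}) (i : 'I_m) :
  maximally_monotone dot (A i) -> lambda i < 1 ->
  x i = resolvent (scale_op (1 - lambda i)^-1 (A i))
          (\sum_(j < m | j != i) (lambda j / (1 - lambda i)) *: x j) <->
  x i = resolvent (A i) (\sum_(j < m) lambda j *: x j).
Proof.
move=> Aimax li; set mu := 1 - lambda i.
have mu_gt0 : 0 < mu by rewrite subr_gt0.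
have mu_neq0 : mu != 0 by rewrite gt_eqF.
have muAmax : maximally_monotone dot (scale_op mu^-1 (A i)).
  by apply: maximally_monotone_scale; rewrite ?invr_gt0.
rewrite (resolventP _ _ muAmax) (resolventP _ _ Aimax).
have -> : \sum_(j < m | j != i) (lambda j / mu) *: x j - x i =
    mu^-1 *: (\sum_(j < m) lambda j *: x j - x i).
  have -> : \sum_(j < m) lambda j *: x j - x i =
      \sum_(j < m | j != i) lambda j *: x j - mu *: x i.
    by rewrite (bigD1 i)//= addrAC addrC /mu scalerBl scale1r opprB.
  rewrite scalerBr scalerA mulVf// scale1r scaler_sumr.
  by congr (_ - _); apply: eq_bigr => j _; rewrite scalerA mulrC.
split=> [[u Au]|Au]; last by exists (\sum_(j < m) lambda j *: x j - x i).
by move=> /scalerI <-//; rewrite invr_eq0.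
Qed.

End Resolvent.

(** * Fixed points of a convex combination of resolvents *)

Theorem theorem2p1 (R : realType) (X : completeNormedModType R)
    (dot : {dot X for idfun}) (dot_norm : induces_norm dot)
    (X_neq0 : exists x : X, x != 0)
    (m : nat) (m_ge2 : (2 <= m)%N)
    (A : 'I_m -> X -> set X)
    (A_maxmon : forall i, maximally_monotone dot (A i))
    (lambda : 'I_m -> R)
    (lambda_itv : forall i, 0 < lambda i < 1)
    (lambda_sum : \sum_(i < m) lambda i = 1) :
  let mu := fun i => 1 - lambda i in
  let JA := fun x : X => \sum_(i < m) lambda i *: resolvent (A i) x in
  let S : set {ffun 'I_m -> X} :=
    [set x : {ffun 'I_m -> X} | forall i : 'I_m,
      x i = resolvent (scale_op (mu i)^-1 (A i))
              (\sum_(j < m | j != i) (lambda j / mu i) *: x j)] in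
  let L := fun x : {ffun 'I_m -> X} => \sum_(i < m) lambda i *: x i in
  let Linv := fun x : X => [ffun i : 'I_m => resolvent (A i) x] in
  [/\ set_bij S (fix_set JA) L,
      forall x y, S x -> S y -> `|L x - L y| <= 1 * prod_norm dot (x - y),
      [/\ set_fun (fix_set JA) S Linv,
          {in S, cancel L Linv} & {in fix_set JA, cancel Linv L}]
    & forall x y, fix_set JA x -> fix_set JA y ->
        prod_norm dot (Linv x - Linv y) <= Num.sqrt m%:R * `|x - y|].
Proof.
move=> mu JA S L Linv.
(* Everything except the two Lipschitz bounds is formal from this equation and
   [JAE]. *)
have SE x : S x <-> x = Linv (L x).
  split=> [Sx|xL i].
    apply/ffunP => i; rewrite ffunE.
    have /andP[_ li] := lambda_itv i.
    exact: (resolvent_regrouped_eq dot_norm x (A_maxmon i) li).1 (Sx i).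
  have /andP[_ li] := lambda_itv i.
  apply: (resolvent_regrouped_eq dot_norm x (A_maxmon i) li).2.
  by rewrite [LHS](congr1 (fun z => fun_of_fin z i) xL) ffunE.
have JAE x : JA x = L (Linv x).
  by apply: eq_bigr => i _; rewrite ffunE.
have LK : {in S, cancel L Linv} by move=> x /set_mem/SE <-.
have LinvK : {in fix_set JA, cancel Linv L}.
  by move=> x /set_mem; rewrite /fix_set /= JAE => <-.
have L_fun : set_fun S (fix_set JA) L.
  by move=> x Sx; rewrite /fix_set /= JAE LK// inE.
have Linv_fun : set_fun (fix_set JA) S Linv.
  by move=> x xF; apply/SE; rewrite LinvK// inE.
split=> //.
- split=> //; first exact: can_in_inj LK.
  by move=> x xF; exists (Linv x); [exact: Linv_fun|rewrite LinvK// inE].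
- move=> x y _ _; rewrite mul1r.
  have -> : L x - L y = \sum_(i < m) lambda i *: (x - y) i.
    by rewrite /L -sumrB; apply: eq_bigr => i _; rewrite !ffunE scalerBr.
  apply: (norm_convex_comb_le dot_norm) => // i.
  by have /andP[/ltW] := lambda_itv i.
- move=> x y _ _; apply: (prod_norm_le dot_norm) => i.
  by rewrite !ffunE; exact: (resolvent_nonexpansive dot_norm).
Qed.
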